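(* Let $\{|\varphi_i\rangle\}_{i\in\mathcal I}$ be a finite set of pure states on $\mathbb{C}^d$ with $\varphi_i=|\varphi_i\rangle\langle\varphi_i|$. Let $G$ be a finite group acting on $\mathcal I$, with unitaries $U_g$ on $\mathbb{C}^d$ such that $\varphi_{gi}=U_g\varphi_iU_g^\dagger$ for all $g\in G$, $i\in\mathcal I$. Let $\mathbf P$ be a nonempty convex set of probability distributions on $\mathcal I$ that is stable under the induced action, i.e. $p\in\mathbf P$ implies $p^g\in\mathbf P$ for all $g$, where $p^g(i)=p(g^{-1}i)$. Let $\mathbf P^G=\{p\in\mathbf P: p^g=p\ \forall g\in G\}$. Then for every $R\ge0$, $M(\mathcal{E},\mathbf P,R)=M(\mathcal{E},\mathbf P^G,R)$.
   Context: For a distribution $p$ on $\mathcal I$, $M(\mathcal{E},p,R)$ is defined as follows. For a finite set $\mathcal J$ and conditional distribution $p(j|i)$, let $\rho^{ABC}=\sum_ip(i)|i\rangle\langle i|\otimes\varphi_i\otimes\sum_jp(j|i)|j\rangle\langle j|$, with $S(A:C)=S(A)+S(C)-S(AC)$ and $S(A:B|C)=S(AC)+S(BC)-S(ABC)-S(C)$ (von Neumann entropies, base 2). Then $M(\mathcal{E},p,R)=\inf\{S(A:B|C):S(A:C)\le R\}$ over all finite $\mathcal J$ and conditional distributions. For a set $\mathbf S$ of distributions, $M(\mathcal{E},\mathbf S,R)=\sup_{p\in\mathrm{conv}(\mathbf S)}M(\mathcal{E},p,R)$. *)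

(* Defs.v *)
From mathcomp Require Import all_boot all_order all_algebra.
From mathcomp Require Import all_classical all_reals.
From mathcomp Require Import exp.
From mathcomp Require Import complex.
Set Implicit Arguments. Unset Strict Implicit. Unset Printing Implicit Defensive.
Import Order.TTheory GRing.Theory Num.Theory.
Local Open Scope ring_scope.
Local Open Scope classical_set_scope.

Section QDefs.
Variable R : realType.
Local Notation C := R[i].

Definition log2 (x : R) : R := ln x / ln 2.
Definition eta2 (x : R) : R := if x == 0 then 0 else - (x * log2 x).

Definition adjmx m n (A : 'M[C]_(m, n)) : 'M[C]_(n, m) := (map_mx Num.conj A)^T.
Definition unitary n (U : 'M[C]_n) : Prop := U *m adjmx U = 1%:M.
Definition dens n (v : 'cV[C]_n) : 'M[C]_n := v *m adjmx v.
Definition unit_ket n (v : 'cV[C]_n) : Prop := adjmx v *m v = 1%:M.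

(* eigenvalues (with multiplicity) of a square complex matrix: the roots of
   its characteristic polynomial, which splits over the closed field R[i] *)
Definition spectrum n (A : 'M[C]_n) : seq C :=
  projT1 (closed_field_poly_normal (char_poly A)).

(* von Neumann entropy (base 2) of a Hermitian matrix: sum of -l log2 l over
   its (real) eigenvalues l *)
Definition vN_entropy n (A : 'M[C]_n) : R :=
  \sum_(z <- spectrum A) eta2 (complex.Re z).

(* operators on the Hilbert space C^T with a finite basis indexed by T *)
Definition op (T : finType) := T -> T -> C.
Definition mx_of_op (T : finType) (f : op T) : 'M[C]_#|{: T}| :=
  \matrix_(a, b) f (enum_val a) (enum_val b).
Definition S (T : finType) (f : op T) : R := vN_entropy (mx_of_op f).

Definition is_dist (I : finType) (p : I -> R) : Prop :=
  (forall i, 0 <= p i) /\ \sum_i p i = 1.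
Definition is_cond (I J : finType) (c : I -> J -> R) : Prop :=
  forall i, is_dist (c i).

Section State.
Variables (I J : finType) (d : nat) (phi : I -> 'cV[C]_d).
Variables (p : I -> R) (c : I -> J -> R).

(* rho^{ABC} = sum_i p(i) |i><i| (x) phi_i (x) sum_j p(j|i) |j><j| *)
Definition rhoABC : op (I * 'I_d * J)%type := fun x y =>
  if (x.1.1 == y.1.1) && (x.2 == y.2)
  then Complex (p x.1.1 * c x.1.1 x.2) 0 * dens (phi x.1.1) x.1.2 y.1.2
  else 0.
Definition rhoAC : op (I * J)%type := fun x y =>
  \sum_(b : 'I_d) rhoABC (x.1, b, x.2) (y.1, b, y.2).
Definition rhoBC : op ('I_d * J)%type := fun x y =>
  \sum_(i : I) rhoABC (i, x.1, x.2) (i, y.1, y.2).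
Definition rhoA : op I := fun x y =>
  \sum_(b : 'I_d) \sum_(j : J) rhoABC (x, b, j) (y, b, j).
Definition rhoC : op J := fun x y =>
  \sum_(i : I) \sum_(b : 'I_d) rhoABC (i, b, x) (i, b, y).

Definition mutinf_AC : R := S rhoA + S rhoC - S rhoAC.
Definition condmutinf_AB_C : R := S rhoAC + S rhoBC - S rhoABC - S rhoC.
End State.

Definition M_point (I : finType) (d : nat) (phi : I -> 'cV[C]_d)
    (p : I -> R) (r : R) : R :=
  inf [set x | exists (J : finType) (c : I -> J -> R),
         [/\ is_cond c, mutinf_AC phi p c <= r & x = condmutinf_AB_C phi p c]].

Definition conv (I : finType) (Q : set (I -> R)) : set (I -> R) :=
  [set p | exists (n : nat) (w : 'I_n -> R) (q : 'I_n -> I -> R),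
     [/\ forall k, Q (q k), forall k, 0 <= w k, \sum_k w k = 1 &
         p = fun i => \sum_k w k * q k i]].

Definition M_set (I : finType) (d : nat) (phi : I -> 'cV[C]_d)
    (Q : set (I -> R)) (r : R) : R :=
  sup [set M_point phi p r | p in conv Q].

End QDefs.

(* Main.v *)
Require Import Defs.
From mathcomp Require Import all_boot all_order all_algebra all_fingroup.
From mathcomp Require Import all_classical all_reals.
From mathcomp Require Import exp.
From mathcomp Require Import complex spectral ring lra.
Import Order.TTheory GRing.Theory Num.Theory.
Local Open Scope ring_scope.
Local Open Scope classical_set_scope.
Set Implicit Arguments.
Unset Strict Implicit.
Unset Printing Implicit Defensive.

(** Let [q] be the average of the translates [p^g]; it lies in [P^G], so it
    suffices that [M(p, R) <= M(q, R)].  A channel [c] feasible for [q] is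
    simulated on [p] by drawing [g] uniformly, applying [c] to [g i] and
    outputting [(g, j)].  The new [S(A:C)] is the average over [g] of the mutual
    informations of the [p^g], and the new [S(A:B|C)] is, by covariance of the
    ensemble, the average of their conditional mutual informations.  For a fixed
    channel both quantities are concave in the input distribution: the first by
    concavity of the Shannon entropy, and the second because, all signals being
    pure, it equals [S(B|C)].  Concavity of [S(B|C)] follows from the log-sum
    inequality applied to the diagonals of the blocks in an eigenbasis of their
    sum, diagonals having at least the entropy of the spectrum. *)

(** * The log-sum inequality *)

Section Scalar.
Variable R : realType.

Lemma sumr_ge0_eq0 (K : finType) (x : K -> R) :
  (forall k, 0 <= x k) -> \sum_k x k = 0 -> forall k, x k = 0.
Proof.
move=> x0 /eqP; rewrite psumr_eq0 => [/allP xE k|k _]; last exact: x0.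
exact/eqP/xE/mem_index_enum.
Qed.

(** The tangent bound [ln y <= y - 1] is used with [y = (q k / x k) * (X / Q)]. The factor [X / Q]
    makes the linear parts sum to [Q * (X / Q) - X = 0]. *)
Lemma log_sum_ln (K : finType) (x q : K -> R) :
  (forall k, 0 <= x k) -> (forall k, 0 <= q k) ->
  (forall k, q k = 0 -> x k = 0) ->
  \sum_k x k * (ln (q k) - ln (x k)) <=
  (\sum_k x k) * (ln (\sum_k q k) - ln (\sum_k x k)).
Proof.
move=> x0 q0 qx; set X := \sum_k x k; set Q := \sum_k q k.
have [XE|Xn0] := eqVneq X 0.
  by rewrite XE mul0r big1// => k _; rewrite (sumr_ge0_eq0 x0 XE) mul0r.
have X0 : 0 < X by rewrite lt_def Xn0 sumr_ge0.
have Q0 : 0 < Q.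
  rewrite lt_def sumr_ge0// andbT; apply: contra_neq Xn0 => QE.
  by rewrite /X big1// => k _; exact/qx/(sumr_ge0_eq0 q0 QE).
have tangent k : x k * (ln (q k) - ln (x k)) <=
    q k * (X / Q) - x k + x k * (ln Q - ln X).
  have [xE|xn0] := eqVneq (x k) 0.
    by rewrite xE !mul0r subr0 addr0 mulr_ge0 ?q0// divr_ge0 ?ltW.
  have xk : 0 < x k by rewrite lt_def xn0 x0.
  have qk : 0 < q k by rewrite lt_def q0 andbT; apply: contra_neq xn0 => /qx.
  have XQ : 0 < X / Q by exact: divr_gt0.
  have qXQ : 0 < q k * (X / Q) by exact: mulr_gt0.
  have y0 : 0 < q k * (X / Q) / x k by exact: divr_gt0.
  have := @le_ln1Dx R (q k * (X / Q) / x k - 1).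
  rewrite ltrBDr addNr => /(_ y0); rewrite addrC subrK.
  rewrite ln_div ?posrE// lnM ?posrE// ln_div ?posrE// => /(ler_wpM2l (ltW xk)).
  rewrite [X in _ <= X -> _]mulrBr mulr1 [x k * (_ / x k)]mulrC divfK// => h.
  nra.
apply: (le_trans (ler_sum _ (fun k _ => tangent k))).
rewrite big_split/= sumrB -!mulr_suml -/X -/Q [Q * _]mulrC divfK ?gt_eqF//.
by rewrite subrr add0r.
Qed.

Lemma ln2_gt0 : 0 < ln 2 :> R. Proof. by rewrite ln_gt0// ltr1n. Qed.

Lemma log2M (x y : R) : 0 < x -> 0 < y -> log2 (x * y) = log2 x + log2 y.
Proof. by move=> x0 y0; rewrite /log2 lnM// mulrDl. Qed.

Lemma log2_1 : log2 (1 : R) = 0. Proof. by rewrite /log2 ln1 mul0r. Qed.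

Lemma ler_log2 (x y : R) : 0 < x -> x <= y -> log2 x <= log2 y.
Proof.
move=> x0 xy; rewrite /log2 ler_pM2r ?invr_gt0 ?ln2_gt0//.
by rewrite ler_ln ?posrE ?(lt_le_trans x0).
Qed.

Lemma eta2E (x : R) : eta2 x = - (x * log2 x).
Proof. by rewrite /eta2; case: eqP => // ->; rewrite mul0r oppr0. Qed.

Lemma eta2_0 : eta2 (0 : R) = 0. Proof. by rewrite /eta2 eqxx. Qed.
Lemma eta2_1 : eta2 (1 : R) = 0. Proof. by rewrite eta2E log2_1 mulr0 oppr0. Qed.

Lemma eta2M (x y : R) : 0 <= x -> 0 <= y ->
  eta2 (x * y) = x * eta2 y + y * eta2 x.
Proof.
rewrite le_eqVlt => /predU1P[<-|x0]; first by rewrite mul0r eta2_0 mulr0 mul0r addr0.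
rewrite le_eqVlt => /predU1P[<-|y0]; first by rewrite mulr0 eta2_0 mulr0 mul0r addr0.
by rewrite !eta2E log2M//; ring.
Qed.

Lemma log_sum (K : finType) (x q : K -> R) :
  (forall k, 0 <= x k) -> (forall k, 0 <= q k) ->
  (forall k, q k = 0 -> x k = 0) ->
  \sum_k (x k * log2 (q k) + eta2 (x k)) <=
  (\sum_k x k) * log2 (\sum_k q k) + eta2 (\sum_k x k).
Proof.
move=> x0 q0 qx; have := log_sum_ln x0 q0 qx.
rewrite -(@ler_pM2r _ (ln 2)^-1) ?invr_gt0 ?ln2_gt0//.
rewrite -mulrA mulrBl mulrBr eta2E mulr_suml => /(le_trans _) -> //.
by apply: ler_sum => k _; rewrite eta2E -mulrA mulrBl mulrBr.
Qed.

(** The log-sum inequality for [w k * x k] against [w k]: the weights sum to 1, so [log2] of their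
    sum vanishes, and [eta2M] cancels the [log2 (w k)] terms. *)
Lemma jensen_eta2 (K : finType) (w x : K -> R) :
  (forall k, 0 <= w k) -> \sum_k w k = 1 -> (forall k, 0 <= x k) ->
  \sum_k w k * eta2 (x k) <= eta2 (\sum_k w k * x k).
Proof.
move=> w0 w1 x0; have := @log_sum K (fun k => w k * x k) w.
rewrite w1 log2_1 mulr0 add0r => /(_ _ w0) h.
apply: (le_trans _ (h _ _)) => [|k|k ->]; [|exact: mulr_ge0|by rewrite mul0r].
apply: ler_sum => k _; rewrite eta2M// [eta2 (w k)]eta2E.
by rewrite [X in _ <= X](_ : _ = w k * eta2 (x k))//; ring.
Qed.

End Scalar.

(** * Entropy of positive semidefinite matrices *)

Section Entropy.
Variable R : realType.
Local Notation C := R[i].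
Local Notation toC := (real_complex R).

Lemma Re_sum (K : finType) (P : pred K) (z : K -> C) :
  complex.Re (\sum_(k | P k) z k) = \sum_(k | P k) complex.Re (z k).
Proof. exact: (raddf_sum (@complex.Re R : Rcomplex R -> R)). Qed.

Lemma ReZ (x : R) (z : C) : complex.Re (toC x * z) = x * complex.Re z.
Proof. by case: z => a b /=; rewrite mul0r subr0. Qed.

Lemma conj_toC (x : R) : (toC x)^* = toC x.
Proof. by apply/CrealP/complex_realP; exists x. Qed.

Lemma Re_ge0 (z : C) : 0 <= z -> 0 <= complex.Re z.
Proof. by rewrite lecE => /andP[]. Qed.

Lemma adjmxE m n (A : 'M[C]_(m, n)) i j : adjmx A i j = (A j i)^*.
Proof. by rewrite !mxE. Qed.

Lemma adjmxK m n (A : 'M[C]_(m, n)) : adjmx (adjmx A) = A.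
Proof. by apply/matrixP => i j; rewrite !adjmxE conjCK. Qed.

Lemma adjmxM m n k (A : 'M[C]_(m, n)) (B : 'M[C]_(n, k)) :
  adjmx (A *m B) = adjmx B *m adjmx A.
Proof. by rewrite /adjmx map_mxM trmx_mul. Qed.

Lemma adjmx_trC m n (A : 'M[C]_(m, n)) : adjmx A = map_mx Num.conj A^T.
Proof. by rewrite /adjmx map_trmx. Qed.

Lemma unitary_adj n (U : 'M[C]_n) : unitary U -> unitary (adjmx U).
Proof. by rewrite /unitary adjmxK => /mulmx1C. Qed.

Lemma unitaryM n (U V : 'M[C]_n) : unitary U -> unitary V -> unitary (U *m V).
Proof.
move=> uU uV; rewrite /unitary adjmxM mulmxA -[_ *m V *m _]mulmxA uV mulmx1.
exact: uU.
Qed.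

Lemma unitary_sum n (U : 'M[C]_n) a : unitary U ->
  \sum_b complex.Re (U a b * (U a b)^*) = 1.
Proof.
move=> /matrixP/(_ a a); rewrite !mxE eqxx => /(congr1 (@complex.Re R)) /= <-.
by rewrite Re_sum; apply: eq_bigr => b _; rewrite adjmxE.
Qed.

Definition diag_of n (l : 'I_n -> R) : 'M[C]_n := diag_mx (\row_i toC (l i)).

Lemma sandwichE m n k (A : 'M[C]_(m, n)) (l : 'I_n -> R) (B : 'M[C]_(n, k)) a b :
  (A *m diag_of l *m B) a b = \sum_i toC (l i) * (A a i * B i b).
Proof.
rewrite mxE; apply: eq_bigr => i _.
by rewrite mul_mx_diag !mxE mulrCA mulrA.
Qed.

Lemma char_poly_unitary_conj n (U A : 'M[C]_n) : unitary U ->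
  char_poly (U *m A *m adjmx U) = char_poly A.
Proof.
move=> uU; rewrite /char_poly /char_poly_mx.
have mU : map_mx (@polyC C) U *m map_mx (@polyC C) (adjmx U) = 1%:M.
  by rewrite -map_mxM uU map_mx1.
have -> : 'X%:M - map_mx (@polyC C) (U *m A *m adjmx U) =
   map_mx (@polyC C) U *m ('X%:M - map_mx (@polyC C) A)
     *m map_mx (@polyC C) (adjmx U).
  by rewrite mulmxBr mulmxBl scalar_mxC -[_%:M *m _ *m _]mulmxA mU mulmx1 !map_mxM.
by rewrite !det_mulmx mulrAC -det_mulmx mU det1 mul1r.
Qed.

Lemma spectrumP n (A : 'M[C]_n) :
  \prod_(z <- spectrum A) ('X - z%:P) = char_poly A.
Proof.
rewrite /spectrum; case: closed_field_poly_normal => s /= ->.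
by rewrite (eqP (char_poly_monic A)) scale1r.
Qed.

(** [spectrum] is a chosen list of roots; unique factorization fixes it up to permutation, so any
    explicit diagonalization computes the entropy. *)
Lemma vN_entropy_diag n (A V : 'M[C]_n) (l : 'I_n -> R) :
  unitary V -> A = adjmx V *m diag_of l *m V ->
  vN_entropy A = \sum_i eta2 (l i).
Proof.
move=> uV ->; rewrite /vN_entropy.
set s := spectrum _.
have : perm_eq s [seq toC (l i) | i <- enum 'I_n].
  apply: prod_XsubC_eq; rewrite spectrumP -{2}[V]adjmxK.
  rewrite char_poly_unitary_conj; last exact: unitary_adj.
  rewrite char_poly_trig ?diag_mx_is_trig// big_map big_enum/=.
  by apply: eq_bigr => i _; rewrite !mxE eqxx mulr1n.
by move=> /(perm_big _) ->; rewrite big_map big_enum.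
Qed.

Lemma vN_entropy_unitary_conj n (U A : 'M[C]_n) : unitary U ->
  vN_entropy (U *m A *m adjmx U) = vN_entropy A.
Proof.
move=> uU; rewrite /vN_entropy; apply: perm_big; apply: prod_XsubC_eq.
by rewrite !spectrumP char_poly_unitary_conj.
Qed.

Lemma mxtrace_unitary_conj n (U A : 'M[C]_n) : unitary U ->
  \tr (U *m A *m adjmx U) = \tr A.
Proof. by move=> /mulmx1C uU; rewrite mxtrace_mulC mulmxA uU mul1mx. Qed.

(** The spectral theorem for normal matrices; Hermitian symmetry makes the spectral diagonal real,
    so taking real parts loses nothing. *)
Lemma hermitian_diag n (A : 'M[C]_n) : adjmx A = A ->
  exists (V : 'M[C]_n) (l : 'I_n -> R),
    unitary V /\ A = adjmx V *m diag_of l *m V.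
Proof.
move=> hA; have Ah : A \is hermsymmx.
  by apply/is_hermitianmxP; rewrite expr0 scale1r -adjmx_trC hA.
have uV := spectral_unitarymx A.
exists (spectralmx A), (fun i => complex.Re (spectral_diag A 0 i)); split.
  by rewrite /unitary adjmx_trC; exact/unitarymxP.
have /orthomx_spectralP := hermitian_normalmx Ah.
rewrite invmx_unitary// -adjmx_trC => {1}->; congr (_ *m diag_mx _ *m _).
apply/rowP => i; rewrite mxE; apply/esym/RRe_real.
by have /mxOverP := hermitian_spectral_diag_real Ah; apply.
Qed.

Definition psd n (A : 'M[C]_n) : Prop :=
  adjmx A = A /\ forall v : 'cV[C]_n, 0 <= (adjmx v *m A *m v) 0 0.

Lemma diag_conjE n (V A : 'M[C]_n) a :
  (V *m A *m adjmx V) a a = (adjmx (adjmx (row a V)) *m A *m adjmx (row a V)) 0 0.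
Proof.
rewrite adjmxK -row_mul !mxE; apply: eq_bigr => b _.
by rewrite !adjmxE !mxE.
Qed.

Lemma psd_diag_ge0 n (V A : 'M[C]_n) a : psd A ->
  0 <= (V *m A *m adjmx V) a a.
Proof. by rewrite diag_conjE => -[_]; exact. Qed.

Lemma psd_diag n (A : 'M[C]_n) : psd A ->
  exists (V : 'M[C]_n) (l : 'I_n -> R),
    [/\ unitary V, forall i, 0 <= l i & A = adjmx V *m diag_of l *m V].
Proof.
move=> pA; have [V [l [uV AE]]] := hermitian_diag pA.1.
exists V, l; split=> // i; have := psd_diag_ge0 V i pA.
rewrite AE !mulmxA uV mul1mx -mulmxA uV mulmx1 !mxE eqxx mulr1n.
by rewrite ler0c.
Qed.

Lemma psd_sum n (K : finType) (A : K -> 'M[C]_n) :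
  (forall k, psd (A k)) -> psd (\sum_k A k).
Proof.
move=> pA; split=> [|v].
  rewrite /adjmx map_mx_sum linear_sum; apply: eq_bigr => k _; exact: (pA k).1.
by rewrite mulmx_sumr mulmx_suml summxE sumr_ge0// => k _; exact: (pA k).2.
Qed.

(** Schur's argument: the diagonal is the image of the spectrum under the doubly stochastic matrix
    of the [|Z a b|^2], and averaging can only increase a sum of the concave [eta2]. *)
Lemma vN_entropy_le_diag n (A V : 'M[C]_n) : psd A -> unitary V ->
  vN_entropy A <= \sum_a eta2 (complex.Re ((V *m A *m adjmx V) a a)).
Proof.
move=> /psd_diag[W [l [uW l0 AE]]] uV.
pose Z := V *m adjmx W; have uZ : unitary Z := unitaryM uV (unitary_adj uW).
pose D a b := complex.Re (Z a b * (Z a b)^*).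
have D0 a b : 0 <= D a b by apply/Re_ge0; rewrite -normCK exprn_ge0.
have Dcol b : \sum_a D a b = 1.
  rewrite -(unitary_sum b (unitary_adj uZ)); apply: eq_bigr => a _.
  by rewrite adjmxE conjCK mulrC.
rewrite (vN_entropy_diag uW AE).
have -> : \sum_i eta2 (l i) = \sum_a \sum_b D a b * eta2 (l b).
  by rewrite exchange_big; apply: eq_bigr => b _; rewrite -mulr_suml Dcol mul1r.
apply: ler_sum => a _; apply: (le_trans (jensen_eta2 (D0 a) _ l0)).
  exact: unitary_sum.
have -> : V *m A *m adjmx V = Z *m diag_of l *m adjmx Z.
  by rewrite AE /Z adjmxM adjmxK !mulmxA.
rewrite sandwichE Re_sum le_eqVlt; apply/orP; left; apply/eqP; congr eta2.
by apply: eq_bigr => b _; rewrite ReZ adjmxE mulrC.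
Qed.

(* For a block [A] of trace [q] this is [q] times the entropy of [A / q]: the
   conditional entropy contributed by a classical value of probability [q]. *)
Definition block_entropy n (A : 'M[C]_n) : R :=
  vN_entropy A - eta2 (complex.Re (\tr A)).

Lemma block_entropy_unitary_conj n (U A : 'M[C]_n) : unitary U ->
  block_entropy (U *m A *m adjmx U) = block_entropy A.
Proof.
by move=> uU; rewrite /block_entropy vN_entropy_unitary_conj// mxtrace_unitary_conj.
Qed.

Lemma Re_tr_sum_diag n (V A : 'M[C]_n) : unitary V ->
  \sum_a complex.Re ((V *m A *m adjmx V) a a) = complex.Re (\tr A).
Proof. by move=> uV; rewrite -Re_sum -(mxtrace_unitary_conj A uV). Qed.

Lemma Re_tr_ge0 n (A : 'M[C]_n) : psd A -> 0 <= complex.Re (\tr A).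
Proof.
move=> pA; have uI : unitary (1%:M : 'M[C]_n).
  by rewrite /unitary mul1mx; apply/matrixP => i j; rewrite !mxE eq_sym conjC_nat.
rewrite -(Re_tr_sum_diag A uI); apply: sumr_ge0 => a _.
exact/Re_ge0/psd_diag_ge0.
Qed.

(** Block entropy scales linearly with the block, so superadditivity amounts to concavity of
    [S(B|C)]. In an eigenbasis of the sum the right side depends on diagonals only; on the left,
    passing to diagonals increases each entropy and keeps the traces. *)
Lemma block_entropy_sum n (K : finType) (A : K -> 'M[C]_n) :
  (forall k, psd (A k)) ->
  \sum_k block_entropy (A k) <= block_entropy (\sum_k A k).
Proof.
move=> pA; have [V [l [uV l0 SE]]] := psd_diag (psd_sum pA).
pose x k a := complex.Re ((V *m A k *m adjmx V) a a).
pose q k := complex.Re (\tr (A k)).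
have x0 k a : 0 <= x k a by exact/Re_ge0/psd_diag_ge0.
have q0 k : 0 <= q k by exact: Re_tr_ge0.
have xq k : \sum_a x k a = q k by exact: Re_tr_sum_diag.
(* The support condition of [log_sum]. *)
have qx k a : q k = 0 -> x k a = 0.
  by rewrite -xq => /(sumr_ge0_eq0 (x0 k)).
have lx a : l a = \sum_k x k a.
  rewrite /x -Re_sum -summxE -mulmx_suml -mulmx_sumr SE !mulmxA uV mul1mx.
  by rewrite -mulmxA uV mulmx1 !mxE eqxx mulr1n.
have QE : complex.Re (\tr (\sum_k A k)) = \sum_k q k.
  by rewrite [\tr _]linear_sum Re_sum.
have blockE k : \sum_a (x k a * log2 (q k) + eta2 (x k a)) =
    \sum_a eta2 (x k a) - eta2 (q k).
  by rewrite big_split -mulr_suml xq/= [eta2 (q k)]eta2E opprK addrC.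
apply: (@le_trans _ _ (\sum_k \sum_a (x k a * log2 (q k) + eta2 (x k a)))).
  apply: ler_sum => k _; rewrite blockE /block_entropy lerB//.
  exact: vN_entropy_le_diag.
rewrite exchange_big /block_entropy (vN_entropy_diag uV SE) QE.
have -> : \sum_i eta2 (l i) - eta2 (\sum_k q k) =
    \sum_a (l a * log2 (\sum_k q k) + eta2 (l a)).
  rewrite big_split -mulr_suml/= [eta2 (\sum_k q k)]eta2E opprK [LHS]addrC.
  congr (_ * _ + _); under [in RHS]eq_bigr do rewrite lx.
  by rewrite exchange_big; apply: eq_bigr => k _; rewrite xq.
apply: ler_sum => a _; rewrite lx; apply: log_sum => // k.
exact: qx.
Qed.

(** Each eigenvalue is at most the trace, so its logarithm is at most that of the trace. This later
    bounds the set defining [M_point] from below. *)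
Lemma block_entropy_ge0 n (A : 'M[C]_n) : psd A -> 0 <= block_entropy A.
Proof.
move=> pA; have [V [l [uV l0 AE]]] := psd_diag pA.
have trE : complex.Re (\tr A) = \sum_a l a.
  rewrite -(Re_tr_sum_diag A uV); apply: eq_bigr => a _.
  by rewrite AE !mulmxA uV mul1mx -mulmxA uV mulmx1 !mxE eqxx mulr1n.
rewrite /block_entropy (vN_entropy_diag uV AE) trE [eta2 (\sum_a _)]eta2E opprK.
rewrite mulr_suml -big_split/= sumr_ge0// => a _; rewrite eta2E addrC -mulrBr.
have := l0 a; rewrite le_eqVlt => /predU1P[<-|la]; first by rewrite mul0r.
rewrite mulr_ge0// subr_ge0 ler_log2//.
by rewrite (bigD1 a)//= lerDl sumr_ge0.
Qed.

End Entropy.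

(** * Entropies of the classical-quantum state *)

Section Operators.
Variable R : realType.
Local Notation C := R[i].
Local Notation toC := (real_complex R).

(** Equal cardinality makes the orthonormal family the rows of a unitary [V]; the conjugate sits on
    the first factor to match [adjmx V *m diag_of l *m V]. *)
Lemma S_orthonormal (T K : finType) (f : op R T) (e : K -> T -> C) (l : K -> R) :
  #|K| = #|T| ->
  (forall k k', \sum_x e k x * (e k' x)^* = (k == k')%:R) ->
  (forall x y, f x y = \sum_k toC (l k) * ((e k x)^* * e k y)) ->
  S f = \sum_k eta2 (l k).
Proof.
move=> KT eo fE; pose g (a : 'I_#|T|) : K := enum_val (cast_ord (esym KT) a).
have gbij : bijective g.
  exists (fun k => cast_ord KT (enum_rank k)) => [a|k].
    by rewrite /g enum_valK cast_ordKV.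
  by rewrite /g cast_ordK enum_rankK.
rewrite (reindex g (onW_bij _ gbij))/=.
pose V := \matrix_(a < #|T|, b < #|T|) e (g a) (enum_val b).
have eV : {on predT, bijective (@enum_val T predT)} by apply/onW_bij/enum_val_bij.
apply: (@vN_entropy_diag _ _ _ V).
  apply/matrixP => a a'; rewrite !mxE -(inj_eq (bij_inj gbij)) -eo.
  rewrite [RHS](reindex _ eV); apply: eq_bigr => b _.
  by rewrite adjmxE !mxE.
apply/matrixP => a b; rewrite sandwichE mxE fE (reindex g (onW_bij _ gbij))/=.
by apply: eq_bigr => k _; rewrite adjmxE !mxE.
Qed.

Lemma S_diagonal (T : finType) (f : op R T) (l : T -> R) :
  (forall x y, f x y = if x == y then toC (l x) else 0) ->
  S f = \sum_x eta2 (l x).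
Proof.
move=> fE; apply: (@S_orthonormal _ _ _ (fun x y => (x == y)%:R)) => // [k k'|x y].
  rewrite (bigD1 k)//= eqxx mul1r conjC_nat eq_sym big1 ?addr0// => x.
  by rewrite eq_sym => /negPf ->; rewrite mul0r.
rewrite fE (bigD1 x)//= eqxx conjC_nat mul1r big1 => [|k /negPf ->].
  by rewrite addr0; case: eqP => _; rewrite ?mulr1 ?mulr0.
by rewrite conjC_nat mul0r mulr0.
Qed.

(** The map [h] relabels the basis with the classical register first. Eigenbases of the blocks,
    extended by zero, form an eigenbasis of the whole operator. *)
Lemma S_blocks (T J : finType) n (h : J * 'I_n -> T) (f : op R T)
    (A : J -> 'M[C]_n) :
  bijective h -> (forall j, adjmx (A j) = A j) ->
  (forall j b j' b', f (h (j, b)) (h (j', b')) =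
     if j == j' then A j b b' else 0) ->
  S f = \sum_j vN_entropy (A j).
Proof.
move=> hbij hA fE.
have [V hV] := choice (fun j => hermitian_diag (hA j)).
have [l {}hV] := choice hV.
have [h' hK h'K] := hbij.
pose e (k : J * 'I_n) x := if k.1 == (h' x).1 then V k.1 k.2 (h' x).2 else 0.
rewrite (@S_orthonormal _ _ _ e (fun k => l k.1 k.2)).
- rewrite -(pair_big predT predT (fun j k => eta2 (l j k)))/=.
  by apply: eq_bigr => j _; have [uV AE] := hV j; rewrite (vN_entropy_diag uV AE).
- exact: bij_eq_card hbij.
- move=> [j k] [j' k']; rewrite (reindex h (onW_bij _ hbij))/= /e/=.
  under eq_bigr do rewrite hK.
  rewrite -(pair_big predT predT (fun i b =>
     (if j == i then V j k b else 0) * (if j' == i then V j' k' b else 0)^*))/=.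
  rewrite (bigD1 j)//= eqxx [X in _ + X]big1 ?addr0; last first.
    by move=> i; rewrite eq_sym => /negPf ij; apply: big1 => b _; rewrite ij mul0r.
  rewrite xpair_eqE [j' == j]eq_sym; case: eqP => [<-|_] /=; last first.
    by rewrite big1// => b _; rewrite conjC0 mulr0.
  have [/matrixP/(_ k k')] := hV j; rewrite !mxE => <- _.
  by apply: eq_bigr => b _; rewrite adjmxE.
- move=> x y; rewrite -[x]h'K -[y]h'K; case: (h' x) (h' y) => [j b] [j' b'].
  rewrite fE /e/= !hK/=.
  rewrite -(pair_big predT predT (fun i k => toC (l i k) *
     ((if i == j then V i k b else 0)^* * (if i == j' then V i k b' else 0))))/=.
  rewrite (bigD1 j)//= eqxx [X in _ + X]big1 ?addr0; last first.
    by move=> i /negPf ij; apply: big1 => k _; rewrite ij conjC0 mul0r mulr0.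
  case: eqP => _; last by rewrite big1// => k _; rewrite !mulr0.
  have [_ ->] := hV j; rewrite sandwichE; apply: eq_bigr => k _.
  by rewrite adjmxE.
Qed.

End Operators.

(** * Closed forms for an ensemble of pure states *)

Section Ensemble.
Variables (R : realType) (I : finType) (d : nat) (phi : I -> 'cV[R[i]]_d).
Hypothesis phi1 : forall i, unit_ket (phi i).
Local Notation C := R[i].
Local Notation toC := (real_complex R).

Lemma adjmx_dens n (v : 'cV[C]_n) : adjmx (dens v) = dens v.
Proof. by rewrite /dens adjmxM adjmxK. Qed.

Lemma adjmxZ n (x : R) (A : 'M[C]_n) : adjmx (toC x *: A) = toC x *: adjmx A.
Proof. by apply/matrixP => i j; rewrite !mxE rmorphM/= conj_toC. Qed.

Lemma mxtrace_dens n (v : 'cV[C]_n) : unit_ket v -> \tr (dens v) = 1.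
Proof. by move=> v1; rewrite mxtrace_mulC v1 mxtrace1. Qed.

Lemma psd_dens n (x : R) (v : 'cV[C]_n) : 0 <= x -> psd (toC x *: dens v).
Proof.
move=> x0; split=> [|u]; first by rewrite adjmxZ adjmx_dens.
rewrite -scalemxAr -scalemxAl mxE mulr_ge0 ?ler0c//.
have -> : adjmx u *m dens v *m u = (adjmx u *m v) *m adjmx (adjmx u *m v).
  by rewrite adjmxM adjmxK !mulmxA.
by rewrite mxE big_ord1 adjmxE -normCK exprn_ge0.
Qed.

(** The projector [dens v] is idempotent of trace 1, so its eigenvalues are 0 or 1 and sum to 1. *)
Lemma vN_entropy_dens n (x : R) (v : 'cV[C]_n) : 0 <= x -> unit_ket v ->
  vN_entropy (toC x *: dens v) = eta2 x.
Proof.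
move=> x0 v1; have [V [l [uV DE]]] := hermitian_diag (adjmx_dens v).
have DV : V *m dens v *m adjmx V = diag_of l.
  by rewrite DE !mulmxA uV mul1mx -mulmxA uV mulmx1.
have ll a : l a = 0 \/ l a = 1.
  have : diag_of l *m diag_of l = diag_of l.
    rewrite -DV !mulmxA -[_ *m adjmx V *m V]mulmxA (mulmx1C uV) mulmx1.
    by rewrite -[_ *m adjmx v *m v]mulmxA v1 mulmx1.
  move=> /matrixP/(_ a a); rewrite mul_diag_mx !mxE eqxx mulr1n -rmorphM.
  move=> /complexI/eqP; rewrite -subr_eq0 -[X in _ - X]mulr1 -mulrBr mulf_eq0.
  by rewrite subr_eq0 => /orP[]/eqP; [left|right].
have l1 : \sum_a l a = 1.
  have := mxtrace_dens v1; rewrite -(mxtrace_unitary_conj _ uV) DV.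
  rewrite mxtrace_diag => /(congr1 (@complex.Re R)) /= <-; rewrite Re_sum.
  by apply: eq_bigr => a _; rewrite mxE.
rewrite (@vN_entropy_diag _ _ _ V (fun a => x * l a))//; last first.
  rewrite {1}DE; apply/matrixP => a b; rewrite mxE !sandwichE mulr_sumr.
  by apply: eq_bigr => k _; rewrite rmorphM !mulrA.
(* Weighting by the [l a] avoids singling out the index of the eigenvalue 1. *)
rewrite -[RHS]mul1r -l1 mulr_suml; apply: eq_bigr => a _.
by case: (ll a) => ->; rewrite ?mulr0 ?mulr1 ?mul0r ?mul1r ?eta2_0.
Qed.

(** Not normalized: with weights [p i * c i j] this is the block of [rhoBC] at the classical value
    [j]. *)
Definition mixture (w : I -> R) : 'M[C]_d := \sum_i toC (w i) *: dens (phi i).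

Lemma psd_mixture w : (forall i, 0 <= w i) -> psd (mixture w).
Proof. by move=> w0; apply: psd_sum => i; exact: psd_dens. Qed.

Lemma Re_tr_mixture w : complex.Re (\tr (mixture w)) = \sum_i w i.
Proof.
rewrite [\tr _]linear_sum Re_sum; apply: eq_bigr => i _.
by rewrite /= mxtraceZ ReZ mxtrace_dens// mulr1.
Qed.

Section Channel.
Variables (J : finType) (p : I -> R) (c : I -> J -> R).
Hypotheses (hp : is_dist p) (hc : is_cond c).

Let p0 i : 0 <= p i. Proof. exact: hp.1. Qed.
Let c0 i j : 0 <= c i j. Proof. exact: (hc i).1. Qed.
Let c1 i : \sum_j c i j = 1. Proof. exact: (hc i).2. Qed.

Lemma sum_dens_diag i : \sum_b dens (phi i) b b = 1.
Proof. exact: mxtrace_dens. Qed.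

Lemma S_rhoA : S (rhoA phi p c) = \sum_i eta2 (p i).
Proof.
apply: S_diagonal => i i'; rewrite /rhoA /rhoABC/=.
case: eqP => [_|_]; last by rewrite big1// => b _; rewrite big1.
transitivity (toC (\sum_j p i * c i j)); last by rewrite -mulr_sumr c1 mulr1.
rewrite exchange_big rmorph_sum.
by apply: eq_bigr => j _; rewrite eqxx/= -mulr_sumr sum_dens_diag mulr1.
Qed.

Lemma S_rhoC : S (rhoC phi p c) = \sum_j eta2 (\sum_i p i * c i j).
Proof.
apply: S_diagonal => j j'; rewrite /rhoC /rhoABC/=.
under eq_bigr do rewrite eqxx/=.
case: eqP => [_|_]; last by rewrite big1// => i _; rewrite big1.
rewrite rmorph_sum; apply: eq_bigr => i _.
by rewrite -mulr_sumr sum_dens_diag mulr1.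
Qed.

Lemma S_rhoAC : S (rhoAC phi p c) = \sum_i \sum_j eta2 (p i * c i j).
Proof.
rewrite pair_big/=; apply: S_diagonal => -[i j] [i' j']; rewrite /rhoAC /rhoABC/=.
rewrite xpair_eqE; case: ifP => _; last by rewrite big1.
by rewrite -mulr_sumr sum_dens_diag mulr1.
Qed.

Lemma S_rhoBC :
  S (rhoBC phi p c) = \sum_j vN_entropy (mixture (fun i => p i * c i j)).
Proof.
apply: (@S_blocks _ _ _ _ (fun x : J * 'I_d => (x.2, x.1))).
- by exists (fun x => (x.2, x.1)) => -[].
- by move=> j; apply: (psd_mixture _).1 => i; rewrite mulr_ge0.
- move=> j b j' b'; rewrite /rhoBC /rhoABC/=; under eq_bigr do rewrite eqxx/=.
  case: eqP => _; last by rewrite big1.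
  by rewrite /mixture summxE; apply: eq_bigr => i _; rewrite [RHS]mxE.
Qed.

(** Purity enters here: every block is a multiple of a rank-one projector, so the quantum register
    adds no entropy to that of [rhoAC]. *)
Lemma S_rhoABC : S (rhoABC phi p c) = \sum_i \sum_j eta2 (p i * c i j).
Proof.
rewrite pair_big/=.
rewrite (@S_blocks _ _ (I * J)%type d (fun x => (x.1.1, x.2, x.1.2)) _
  (fun x => toC (p x.1 * c x.1 x.2) *: dens (phi x.1))).
- by apply: eq_bigr => x _; rewrite vN_entropy_dens// mulr_ge0.
- by exists (fun x => (x.1.1, x.2, x.1.2)) => -[[]].
- by move=> x; rewrite adjmxZ adjmx_dens.
- move=> [i j] b [i' j'] b'; rewrite /rhoABC/= xpair_eqE.
  by case: ifP => // _; rewrite [RHS]mxE.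
Qed.

(** The classical identity [I(A:C) = H(C) - H(C|A)]; the [eta2 (p i)] parts of the joint entropy
    cancel [S(A)]. *)
Lemma mutinf_ACE : mutinf_AC phi p c =
  \sum_j eta2 (\sum_i p i * c i j) - \sum_i p i * \sum_j eta2 (c i j).
Proof.
rewrite /mutinf_AC S_rhoA S_rhoC S_rhoAC.
have -> : \sum_i \sum_j eta2 (p i * c i j) =
    \sum_i p i * \sum_j eta2 (c i j) + \sum_i eta2 (p i).
  rewrite -big_split; apply: eq_bigr => i _ /=.
  under eq_bigr do rewrite eta2M//.
  by rewrite big_split/= mulr_sumr -mulr_suml c1 mul1r.
by ring.
Qed.

(** [S(AC)] and [S(ABC)] cancel, leaving [S(BC) - S(C)]; the trace of block [j] is the probability
    of [j], so the difference splits over the blocks. *)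
Lemma condmutinf_AB_CE : condmutinf_AB_C phi p c =
  \sum_j block_entropy (mixture (fun i => p i * c i j)).
Proof.
rewrite /condmutinf_AB_C S_rhoAC S_rhoBC S_rhoABC S_rhoC sumrB.
under [\sum_j eta2 (complex.Re _)]eq_bigr do rewrite Re_tr_mixture.
by ring.
Qed.

Lemma condmutinf_AB_C_ge0 : 0 <= condmutinf_AB_C phi p c.
Proof.
rewrite condmutinf_AB_CE sumr_ge0// => j _; apply/block_entropy_ge0/psd_mixture.
by move=> i; rewrite mulr_ge0.
Qed.

End Channel.

(** Ensures that [inf] is a genuine infimum, which requires a nonempty set bounded below. *)
Lemma M_point_has_inf (p : I -> R) (r : R) : is_dist p -> 0 <= r ->
  has_inf [set x | exists (J : finType) (c : I -> J -> R),
    [/\ is_cond c, mutinf_AC phi p c <= r & x = condmutinf_AB_C phi p c]].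
Proof.
move=> hp r0; split; last by exists 0 => _ [J [c [hc _ ->]]]; exact: condmutinf_AB_C_ge0.
(* The channel into a one-point alphabet carries no information, hence is feasible for every
   [r >= 0]. *)
exists (condmutinf_AB_C phi p (fun _ (_ : unit) => 1)), unit, (fun _ _ => 1).
have h1 : is_cond (fun (_ : I) (_ : unit) => 1 : R).
  by move=> i; split=> [_|]; rewrite ?ler01// big_const card_unit/= addr0.
split=> //; rewrite mutinf_ACE// big1 => [|_ _].
  rewrite big1 ?subr0// => i _; rewrite big1 ?mulr0// => j _; exact: eta2_1.
by under eq_bigr do rewrite mulr1; rewrite hp.2 eta2_1.
Qed.

Lemma M_point_le (p q : I -> R) (r : R) : is_dist p -> is_dist q -> 0 <= r ->
  (forall (J : finType) (c : I -> J -> R), is_cond c ->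
    exists (J' : finType) (c' : I -> J' -> R),
      [/\ is_cond c', mutinf_AC phi p c' <= mutinf_AC phi q c &
          condmutinf_AB_C phi p c' <= condmutinf_AB_C phi q c]) ->
  M_point phi p r <= M_point phi q r.
Proof.
move=> hp hq r0 sim; apply: lb_le_inf; first by case: (M_point_has_inf hq r0).
move=> _ [J [c [hc cr ->]]]; have [J' [c' [hc' le1 le2]]] := sim J c hc.
apply: le_trans le2; apply: ge_inf; first by case: (M_point_has_inf hp r0).
by exists J', c'; split=> //; exact: le_trans cr.
Qed.

End Ensemble.

(** * Symmetrization *)

Lemma subset_conv (R : realType) (I : finType) (P : set (I -> R)) : P `<=` conv P.
Proof.
move=> p Pp; exists 1%N, (fun _ => 1), (fun _ => p); split=> //.
  by rewrite big_ord1.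
by apply: funext => i; rewrite big_ord1 mul1r.
Qed.

(** Induction on the number of points: the first is split off and the other weights are renormalized
    by their sum [s = 1 - t]. *)
Lemma conv_subset (R : realType) (I : finType) (P : set (I -> R)) :
  (forall p q (t : R), P p -> P q -> 0 <= t <= 1 ->
     P (fun i => t * p i + (1 - t) * q i)) ->
  conv P `<=` P.
Proof.
move=> cP _ [n [w [q [Pq w0 w1 ->]]]].
elim: n w q Pq w0 w1 => [w q _ _|n IH w q Pq w0 w1].
  by rewrite big_ord0 => /eqP; rewrite eq_sym oner_eq0.
set t := w ord0; pose s := \sum_(k < n) w (lift ord0 k).
have ts : s = 1 - t by rewrite -w1 big_ord_recl addrC addKr.
have s0 : 0 <= s by apply: sumr_ge0.
(* If [s = 0], nothing can be renormalized, but all weight sits on [q ord0]. *)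
have [sE|sn0] := eqVneq s 0.
  rewrite (_ : (fun _ => _) = q ord0)//; apply: funext => i.
  rewrite big_ord_recl big1 ?addr0 => [|k _].
    by move: ts; rewrite sE => /esym/subr0_eq; rewrite -/t => <-; rewrite mul1r.
  by rewrite (sumr_ge0_eq0 (x := fun k => w (lift ord0 k)) _ sE)// mul0r.
rewrite (_ : (fun _ => _) = (fun i => t * q ord0 i +
    (1 - t) * \sum_(k < n) (w (lift ord0 k) / s) * q (lift ord0 k) i)).
  apply: cP => //; last by rewrite w0 -subr_ge0 -ts.
  apply: (IH (fun k => w (lift ord0 k) / s) (fun k => q (lift ord0 k))) => //.
    by move=> k; rewrite divr_ge0.
  by rewrite -mulr_suml divff.
apply: funext => i; rewrite big_ord_recl -ts mulr_sumr; congr (_ + _).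
by apply: eq_bigr => k _; rewrite mulrA mulrCA divff// mulr1.
Qed.

(** * Averaging over the group *)

Section Twirl.
Variables (R : realType) (I : finType) (gT : finGroupType) (act : gT -> I -> I).
Hypothesis act1 : forall i, act 1%g i = i.
Hypothesis actM : forall g h i, act (g * h)%g i = act g (act h i).
Local Notation N := (#|gT|%:R : R).

Lemma actK g : cancel (act g) (act g^-1%g).
Proof. by move=> i; rewrite -actM mulVg act1. Qed.

Lemma actVK g : cancel (act g^-1%g) (act g).
Proof. by move=> i; rewrite -actM mulgV act1. Qed.

Lemma sum_act (V : zmodType) (F : I -> V) g :
  \sum_i F (act g i) = \sum_i F i.
Proof. by rewrite [RHS](reindex_inj (can_inj (actK g))). Qed.

Lemma order_gt0 : 0 < N.
Proof. by rewrite ltr0n; apply/card_gt0P; exists 1%g. Qed.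

Lemma sum_invN : \sum_(g : gT) N^-1 = 1.
Proof. by rewrite sumr_const -[LHS]mulr_natl divff// gt_eqF ?order_gt0. Qed.

Definition twirl (p : I -> R) : I -> R :=
  fun i => \sum_g N^-1 * p (act g^-1%g i).

(** Substituting along the bijection [act g] in each inner sum moves the action between [F] and
    [p]. *)
Lemma sum_twirl (p F : I -> R) :
  \sum_g N^-1 * (\sum_i p i * F (act g i)) = \sum_i twirl p i * F i.
Proof.
under [RHS]eq_bigr do rewrite mulr_suml.
rewrite exchange_big; apply: eq_bigr => g _.
rewrite -[in RHS](sum_act _ g) mulr_sumr; apply: eq_bigr => i _.
by rewrite actK mulrA.
Qed.

(** Left translation by [h] permutes the group, hence the terms of the average. *)
Lemma twirl_act (p : I -> R) h : (fun i => twirl p (act h^-1%g i)) = twirl p.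
Proof.
apply: funext => i; rewrite /twirl [RHS](reindex_inj (mulgI h)).
by apply: eq_bigr => g _; rewrite -actM invMg.
Qed.

Lemma twirl_conv (P : set (I -> R)) (p : I -> R) :
  (forall g, P (fun i => p (act g^-1%g i))) -> conv P (twirl p).
Proof.
move=> Pp; have eV : {on predT, bijective (@enum_val gT predT)}.
  exact/onW_bij/enum_val_bij.
exists #|gT|, (fun _ => N^-1), (fun k i => p (act (enum_val k)^-1%g i)).
split=> //; first by move=> _; rewrite invr_ge0 ltW// order_gt0.
  by rewrite -[RHS]sum_invN [RHS](reindex _ eV).
by apply: funext => i; rewrite /twirl (reindex _ eV).
Qed.

(** * Simulating a channel for the twirled distribution *)

Section Simulation.
Variables (d : nat) (phi : I -> 'cV[R[i]]_d) (U : gT -> 'M[R[i]]_d).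
Hypothesis phi1 : forall i, unit_ket (phi i).
Hypothesis uU : forall g, unitary (U g).
Hypothesis covU :
  forall g i, dens (phi (act g i)) = U g *m dens (phi i) *m adjmx (U g).

Lemma mixture_act (w : I -> R) g :
  U g *m mixture phi w *m adjmx (U g) =
  mixture phi (fun i => w (act g^-1%g i)).
Proof.
rewrite /mixture mulmx_sumr mulmx_suml -[RHS](sum_act _ g).
by apply: eq_bigr => i _; rewrite actK covU -scalemxAr -scalemxAl.
Qed.

Variables (J : finType) (p : I -> R) (c : I -> J -> R).
Hypotheses (hp : is_dist p) (hq : is_dist (twirl p)) (hc : is_cond c).

(** Recording [g] in the output keeps the blocks for different [g] apart, so the information
    quantities become averages over [g]. *)
Definition twirled_channel (i : I) (x : gT * J) : R :=
  N^-1 * c (act x.1 i) x.2.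

Let p0 i : 0 <= p i. Proof. exact: hp.1. Qed.
Let c0 i j : 0 <= c i j. Proof. exact: (hc i).1. Qed.
Let c1 i : \sum_j c i j = 1. Proof. exact: (hc i).2. Qed.
Let N0 : 0 <= N^-1. Proof. by rewrite invr_ge0 ltW// order_gt0. Qed.

Lemma twirled_channel_cond : is_cond twirled_channel.
Proof.
move=> i; split=> [x|]; first by rewrite mulr_ge0.
rewrite -(pair_big predT predT (fun g j => N^-1 * c (act g i) j))/= -[RHS]sum_invN.
by apply: eq_bigr => g _; rewrite -mulr_sumr c1 mulr1.
Qed.

(** Recording [g] adds its entropy both to the output entropy and to the conditional entropy given
    the input, so it cancels. The remaining conditional terms agree exactly; the output terms
    compare by Jensen's inequality. *)
Lemma mutinf_twirled :
  mutinf_AC phi p twirled_channel <= mutinf_AC phi (twirl p) c.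
Proof.
rewrite !mutinf_ACE//; last exact: twirled_channel_cond.
pose y g j := \sum_i p i * c (act g i) j.
have y0 g j : 0 <= y g j by rewrite sumr_ge0// => i _; rewrite mulr_ge0.
have out : \sum_x eta2 (\sum_i p i * twirled_channel i x) =
    \sum_j (\sum_g N^-1 * eta2 (y g j)) + \sum_(g : gT) eta2 N^-1.
  rewrite exchange_big/= -big_split/=.
  rewrite -(pair_big predT predT
    (fun g j => eta2 (\sum_i p i * twirled_channel i (g, j))))/=.
  apply: eq_bigr => g _.
  (* For each [g] the output distribution [y g] sums to 1, so [eta2 N^-1] can be spread over the
     [j]. *)
  have -> : eta2 N^-1 = \sum_j y g j * eta2 N^-1.
    rewrite -mulr_suml exchange_big -[LHS]mul1r -hp.2; congr (_ * _).
    by apply: eq_bigr => i _; rewrite -mulr_sumr c1 mulr1.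
  rewrite -big_split/=; apply: eq_bigr => j _; rewrite -eta2M//; congr eta2.
  by rewrite mulr_sumr; apply: eq_bigr => i _; rewrite mulrCA.
have inp : \sum_i p i * \sum_x eta2 (twirled_channel i x) =
    \sum_i twirl p i * (\sum_j eta2 (c i j)) + \sum_(g : gT) eta2 N^-1.
  pose H i := \sum_j eta2 (c i j).
  have entropyE i : \sum_x eta2 (twirled_channel i x) =
      \sum_g N^-1 * H (act g i) + \sum_(g : gT) eta2 N^-1.
    rewrite -(pair_big predT predT (fun g j => eta2 (N^-1 * c (act g i) j)))/=.
    rewrite -big_split; apply: eq_bigr => g _ /=.
    have -> : eta2 N^-1 = \sum_j c (act g i) j * eta2 N^-1.
      by rewrite -mulr_suml c1 mul1r.
    rewrite mulr_sumr -big_split; apply: eq_bigr => j _ /=.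
    by rewrite eta2M.
  under eq_bigr do rewrite entropyE mulrDr.
  rewrite big_split/= -mulr_suml hp.2 mul1r; congr (_ + _).
  rewrite -sum_twirl; under [RHS]eq_bigr do rewrite mulr_sumr.
  rewrite exchange_big; apply: eq_bigr => i _; rewrite mulr_sumr.
  by apply: eq_bigr => g _; rewrite mulrCA.
rewrite out inp opprD addrACA subrr addr0 lerB// ler_sum// => j _.
rewrite -sum_twirl; exact: jensen_eta2 sum_invN _.
Qed.

(** Conjugation by [U g] preserves block entropy and turns the [(g, j)] block into [A g]. The [A g]
    add up to the [j] block for [twirl p], so superadditivity applies. *)
Lemma condmutinf_twirled :
  condmutinf_AB_C phi p twirled_channel <= condmutinf_AB_C phi (twirl p) c.
Proof.
rewrite !condmutinf_AB_CE//; last exact: twirled_channel_cond.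
rewrite -(pair_big predT predT (fun g j =>
  block_entropy (mixture phi (fun i => p i * twirled_channel i (g, j)))))/=.
rewrite exchange_big; apply: ler_sum => j _.
pose A g := mixture phi (fun i => N^-1 * p (act g^-1%g i) * c i j).
have AE g : block_entropy (mixture phi (fun i => p i * twirled_channel i (g, j))) =
    block_entropy (A g).
  rewrite -(block_entropy_unitary_conj _ (uU g)) mixture_act /A; congr block_entropy.
  (* The channel is evaluated at [act g (act g^-1 i) = i], which frees [c i j] from [g]. *)
  by apply: eq_bigr => i _; rewrite /twirled_channel/= actVK mulrCA mulrA.
have -> : mixture phi (fun i => twirl p i * c i j) = \sum_g A g.
  rewrite exchange_big; apply: eq_bigr => i _.
  by rewrite -scaler_suml -rmorph_sum /twirl mulr_suml.
under eq_bigr do rewrite AE.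
apply: block_entropy_sum => g; apply: psd_mixture => i.
by rewrite !mulr_ge0.
Qed.

End Simulation.
End Twirl.

Unset Implicit Arguments.

Theorem theorem9p1 (R : realType) (I : finType) (d : nat)
    (phi : I -> 'cV[R[i]]_d) (gT : finGroupType) (act : gT -> I -> I)
    (U : gT -> 'M[R[i]]_d) (P : set (I -> R)) (r : R) :
  (forall i, unit_ket (phi i)) ->
  (forall i, act 1%g i = i) ->
  (forall g h i, act (g * h)%g i = act g (act h i)) ->
  (forall g, unitary (U g)) ->
  (forall g i, dens (phi (act g i)) = U g *m dens (phi i) *m adjmx (U g)) ->
  (forall p, P p -> is_dist p) ->
  P !=set0 ->
  (forall p q (t : R), P p -> P q -> 0 <= t <= 1 ->
     P (fun i => t * p i + (1 - t) * q i)) ->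
  (forall p g, P p -> P (fun i => p (act g^-1%g i))) ->
  0 <= r ->
  M_set phi P r =
  M_set phi [set p | P p /\ forall g, (fun i => p (act g^-1%g i)) = p] r.
Proof.
move=> phi1 act1 actM uU covU Pdist _ Pconv Pact r0.
(* Down-closure leaves [sup] unchanged and reduces the equality to mutual domination of values, with
   no separate bound on the sets. *)
rewrite /M_set -[LHS]sup_down -[RHS]sup_down; congr sup; apply/seteqP; split.
- move=> x [_ [[p /(conv_subset Pconv) Pp <-] xp]].
  have Pq : P (twirl act p).
    by apply/(conv_subset Pconv)/twirl_conv => // g; exact: Pact.
  exists (M_point phi (twirl act p) r); split.
    exists (twirl act p) => //; apply: subset_conv; split=> // g.
    exact: twirl_act.
  apply: (le_trans xp); apply: M_point_le => //; [exact: Pdist..|].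
  move=> J c hc; exists (gT * J)%type, (twirled_channel act c); split.
  + exact: twirled_channel_cond.
  + by apply: mutinf_twirled => //; exact: Pdist.
  + by apply: (condmutinf_twirled act1 actM phi1 uU covU) => //; exact: Pdist.
(* Invariant distributions lie in [P], so the same convex combination serves. *)
- move=> x [_ [[p [n [w [q [Pq w0 w1 pE]]]] <-] xp]].
  exists (M_point phi p r); split=> //; exists p => //.
  by exists n, w, q; split=> // k; case: (Pq k).
Qed.
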